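(* Define $k:\mathbb{N}\to\mathbb{N}$ by $k(x) = \lceil (x+1)/2\rceil+1$. Let $G$ be a finite triangle-free graph of minimum degree at least $524$. Then for every list-assignment $L: V(G)\to 2^{\mathbb{N}}$ with $|L(v)| \ge k(\deg(v))$ for all $v\in V(G)$, the graph $G$ admits a proper $L$-colouring.
   Context: $\deg(v)$ is the degree of $v$ in $G$. A list-assignment of $G$ is a map $L: V(G)\to 2^{\mathbb{N}}$. A proper $L$-colouring is a map $c: V(G)\to\mathbb{N}$ with $c(v)\in L(v)$ for all $v$ and $c(u)\ne c(v)$ for every edge $uv$. *)

(* Defs.v *)
From mathcomp Require Import all_boot.
From mathcomp Require Import classical_sets cardinality.

Set Implicit Arguments.
Unset Strict Implicit.
Unset Printing Implicit Defensive.

Local Open Scope classical_set_scope.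

(* A simple graph on the finite vertex type V is given by its adjacency relation. *)
Definition simple_graph (V : finType) (e : rel V) : Prop :=
  symmetric e /\ irreflexive e.

Definition deg (V : finType) (e : rel V) (v : V) : nat := #|[pred u | e v u]|.

Definition triangle_free (V : finType) (e : rel V) : Prop :=
  forall x y z : V, ~ [/\ e x y, e y z & e x z].

Definition min_degree_at_least (V : finType) (e : rel V) (d : nat) : Prop :=
  forall v : V, d <= deg e v.

(* uphalf n is the ceiling of n / 2. *)
Definition k (x : nat) : nat := uphalf (x + 1) + 1.

(* Lists are arbitrary, possibly infinite, sets of naturals. *)
Definition list_assignment (V : finType) : Type := V -> set nat.

(* `I_n is {0, ..., n-1}, so `I_n #<= A says that A has at least n elements,
   which also makes sense for infinite A. *)
Definition card_at_least (n : nat) (A : set nat) : Prop := (`I_n #<= A)%card.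

Definition proper_list_colouring (V : finType) (e : rel V)
    (L : list_assignment V) (c : V -> nat) : Prop :=
  (forall v : V, L v (c v)) /\ (forall u v : V, e u v -> c u <> c v).

(* Main.v *)
(** For a set [S] of vertices let [C(S)] be the set of list colourings of the
    subgraph induced by [S]. By induction on [#|S|], [8 #|C(S)| <= #|C(v |: S)|]
    whenever [v] is not in [S]; hence [C(V)] is nonempty.

    The ratio [#|C(v |: S)| / #|C(S)|] is the mean number of colours left for
    [v] by a uniform random element of [C(S)]. Condition on the colours outside
    [N(v)]. As [N(v)] is independent, each neighbour [u] is then coloured
    uniformly and independently from a set [A_u] of [s_u] colours, and [x] stays
    available at [v] with probability the product of [1 - 1/s_u] over the [u]
    with [x] in [A_u]. That product is at least
    [(3 - sum_u (1/s_u + 2/s_u^2)) / 16], and summing over [x] the mean is at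
    least [(3 #|L(v)| - sum_u (1 + 2/s_u)) / 16]. Finally the mean of [1/s_u]
    over [C(S)] is at most [#|C(S :\ u)| / #|C(S)| <= 1/8] by induction, so for
    [#|L(v)| >= (deg v + 3)/2] the mean is at least
    [(deg v / 4 + 9/2) / 16 >= 8]. *)

Require Import Defs.
From mathcomp Require Import boolp classical_sets functions cardinality.
From mathcomp Require Import all_boot all_order all_algebra.
From mathcomp Require Import reals Rstruct.
From mathcomp Require Import sequences exp.
From mathcomp Require Import zify ring lra.
Set Implicit Arguments.
Unset Strict Implicit.
Unset Printing Implicit Defensive.
Import Order.TTheory GRing.Theory Num.Theory.
Local Open Scope ring_scope.

(** * Exponential lower bounds for products of [1 - y] *)

(** After inversion this follows from [expR t >= 1 + t] and [(1 + y + 2 y^2) (1 - y) = 1 + y^2 (1 -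
    2 y) >= 1]. *)
Lemma expRN_le_1B (R : realType) (y : R) : 0 <= y <= 2^-1 ->
  expR (- (y + 2 * y ^+ 2)) <= 1 - y.
Proof.
move=> /andP[y0 y1]; rewrite expRN -[leRHS]invrK lef_pV2 ?posrE ?expR_gt0 //;
  last by rewrite invr_gt0; lra.
apply: le_trans (expR_ge1Dx _); rewrite -div1r ler_pdivrMr; last lra.
by rewrite expr2; nra.
Qed.

Lemma expRN2_ge (R : realType) : 16^-1 <= expR (- 2 : R).
Proof.
have h : 2^-1 <= expR (- 2^-1 : R) by apply: le_trans (expR_ge1Dx _); lra.
have -> : - 2 = 4%:R * (- 2^-1) :> R by lra.
rewrite expRM_natl (_ : 16^-1 = 2^-1 ^+ 4); last by rewrite !exprS expr0; lra.
by rewrite lerXn2r // nnegrE ?expR_ge0 //; lra.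
Qed.

(* The value [1], which comes from a neighbour with a single available colour,
   is harmless because it contributes [3] to the sum. *)
Lemma prod_1B_ge (R : realType) (I : finType) (P : pred I) (y : I -> R) :
    (forall i, P i -> 0 <= y i <= 2^-1 \/ y i = 1) ->
  16^-1 * (3 - \sum_(i | P i) (y i + 2 * y i ^+ 2)) <= \prod_(i | P i) (1 - y i).
Proof.
move=> hy; have y_ge0 i : P i -> 0 <= y i by move=> /hy[/andP[]|->].
have z_ge0 i : P i -> 0 <= y i + 2 * y i ^+ 2.
  by move=> Pi; rewrite addr_ge0 ?y_ge0 // mulr_ge0 // sqr_ge0.
case: (pickP (fun i => P i && (y i == 1))) => [i /andP[Pi /eqP yi]|no1].
  rewrite [leRHS](bigD1 i) //= yi subrr mul0r (bigD1 i) //= yi expr1n.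
  have : 0 <= \sum_(j | P j && (j != i)) (y j + 2 * y j ^+ 2).
    by apply: sumr_ge0 => j /andP[/z_ge0].
  by lra.
have hz i : P i -> 0 <= y i <= 2^-1.
  by move=> Pi; case: (hy _ Pi) => // yi1; move: (no1 i); rewrite Pi yi1 eqxx.
set Z := \sum_(i | P i) _.
apply: (@le_trans _ _ (expR (- Z))); last first.
  rewrite /Z -sumrN expR_sum; apply: ler_prod => i Pi.
  by rewrite expR_ge0 expRN_le_1B // hz.
(* Tangent line of [expR (- Z)] at [Z = 2]. The factor [expR (- 2)] is lowered to [1/16] while it
   multiplies a positive quantity, because [3 - Z] may be negative. *)
have -> : - Z = - 2 + (2 - Z) by lra.
rewrite expRD; have h := expR_ge1Dx (2 - Z); have k := expRN2_ge R.
have e0 := expR_ge0 (2 - Z).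
have : (expR (- 2) - 16^-1) * expR (2 - Z) >= 0 by rewrite mulr_ge0 // subr_ge0.
by lra.
Qed.

(** * Counting colourings of induced subgraphs *)

Lemma card_family_prod (I D : finType) (F : I -> {set D}) :
  #|[set f : {ffun I -> D} | f \in family (fun i => mem (F i))]|
    = (\prod_i #|F i|)%N.
Proof. by rewrite cardsE card_family foldrE big_image. Qed.

Section PartialColourings.
Variables (V C : finType) (e : rel V) (c0 : C) (A : V -> {set C}).

(* Vertices outside [S] take the dummy colour [c0]. *)
Definition colourings (S : {set V}) : {set {ffun V -> C}} :=
  [set f : {ffun V -> C} |
    [forall v, if v \in S then f v \in A v else f v == c0] &&
    [forall u in S, forall v in S, e u v ==> (f u != f v)]].

(** Also applied to [u] in [S]: for irreflexive [e] the colour [f u] imposes no constraint, so these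
    are the colours that [u] may be recoloured with. *)
Definition avail (S : {set V}) (f : {ffun V -> C}) (u : V) : {set C} :=
  [set x in A u | [forall w in S, e u w ==> (f w != x)]].

Definition upd (f : {ffun V -> C}) (u : V) (x : C) : {ffun V -> C} :=
  [ffun w => if w == u then x else f w].

Lemma colouringsP (S : {set V}) (f : {ffun V -> C}) :
  reflect [/\ forall v, v \in S -> f v \in A v,
              forall v, v \notin S -> f v = c0 &
              forall u v, u \in S -> v \in S -> e u v -> f u != f v]
    (f \in colourings S).
Proof.
rewrite inE; apply: (iffP andP) => [[/forallP h /forall_inP h2]|[hA h0 hp]].
- split=> [v vS|v vS|u v uS vS uv].
  + by have := h v; rewrite vS.
  + by have := h v; rewrite (negPf vS) => /eqP.
  + by have /forall_inP/(_ v vS)/implyP/(_ uv) := h2 u uS.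
- split; first by apply/forallP => v; case: ifPn => vS; [exact: hA|rewrite h0].
  apply/forall_inP => u uS; apply/forall_inP => v vS.
  by apply/implyP; exact: hp.
Qed.

Lemma availP (S : {set V}) (f : {ffun V -> C}) (u : V) (x : C) :
  reflect (x \in A u /\ forall w, w \in S -> e u w -> f w != x)
    (x \in avail S f u).
Proof.
rewrite inE; apply: (iffP andP) => -[xA h]; split=> //.
  by move=> w wS uw; have /forall_inP/(_ w wS)/implyP/(_ uw) := h.
by apply/forall_inP => w wS; apply/implyP; exact: h.
Qed.

Lemma colourings0_gt0 : (0 < #|colourings set0|)%N.
Proof.
apply/card_gt0P; exists [ffun=> c0]; apply/colouringsP.
by split=> [v|v _|u v]; rewrite ?inE ?ffunE.
Qed.

Hypotheses (e_sym : symmetric e) (e_irr : irreflexive e).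

Lemma avail_upd (S : {set V}) (f : {ffun V -> C}) (u : V) (x : C) :
  avail (u |: S) f u = avail S (upd f u x) u.
Proof.
apply/setP => y; apply/availP/availP => -[yA h]; split=> // w.
  move=> wS uw; rewrite ffunE; case: (eqVneq w u) uw => [->|_ uw]; rewrite ?e_irr //.
  by apply: h; rewrite // inE wS orbT.
rewrite !inE => /orP[/eqP->|wS] uw; first by rewrite e_irr in uw.
have := h w wS uw; rewrite ffunE; case: (eqVneq w u) uw => // ->; by rewrite e_irr.
Qed.

Lemma mem_avail (S : {set V}) (f : {ffun V -> C}) (u : V) :
  u \in S -> f \in colourings S -> f u \in avail S f u.
Proof.
move=> uS /colouringsP[hA _ hp]; apply/availP; split; first exact: hA.
by move=> w wS uw; apply: hp; rewrite // e_sym.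
Qed.

Lemma upd_colourings (S : {set V}) (f : {ffun V -> C}) (u : V) : u \notin S ->
  f \in colourings (u |: S) -> upd f u c0 \in colourings S.
Proof.
move=> uS /colouringsP[hA h0 hp]; have neq v : v \in S -> (v == u) = false.
  by move=> vS; apply/eqP => vu; rewrite -vu vS in uS.
apply/colouringsP; split=> [v vS|v vS|v w vS wS vw]; rewrite !ffunE.
- by rewrite neq // hA // inE vS orbT.
- by case: eqVneq => // vu; apply: h0; rewrite !inE negb_or vu.
- by rewrite !neq //; apply: hp; rewrite // inE ?vS ?wS orbT.
Qed.

Lemma card_extensions (S : {set V}) (g : {ffun V -> C}) (u : V) : u \notin S ->
    g \in colourings S ->
  #|[set f in colourings (u |: S) | upd f u c0 == g]| = #|avail S g u|.
Proof.
move=> uS gS; have [hA h0 hp] := colouringsP _ _ gS.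
have neq v : v \in S -> (v == u) = false.
  by move=> vS; apply/eqP => vu; rewrite -vu vS in uS.
rewrite -(@card_imset _ _ (upd g u)); last first.
  by move=> x y /ffunP/(_ u); rewrite !ffunE eqxx.
congr #|pred_of_set _|; apply/setP => f; rewrite inE.
apply/andP/imsetP => [[fS /eqP fg]|[x /availP[xA xn] ->]].
  exists (f u); last first.
    by apply/ffunP => w; rewrite -fg !ffunE; case: eqP => // ->.
  by rewrite -fg -avail_upd mem_avail // setU11.
split; last first.
  apply/eqP/ffunP => w; rewrite !ffunE; case: eqP => // ->.
  by rewrite h0.
apply/colouringsP; split=> [v|v|v w]; rewrite !inE ?negb_or ?ffunE.
- by case: eqVneq => [->|_ /=]; [|exact: hA].
- by case/andP=> /negPf-> /h0.
- case: (eqVneq v u) => [->|vu /= vS]; case: (eqVneq w u) => [->|wu /=].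
  + by rewrite e_irr.
  + by move=> _ wS uw; rewrite eq_sym; apply: xn.
  + by move=> _ uw; apply: xn; rewrite // e_sym.
  + by move=> wS; apply: hp.
Qed.

(** Resetting [u] to [c0] sends colourings of [u |: S] to colourings of [S], and the fibre over [g]
    has [#|avail S g u|] elements. *)
Lemma sum_extensions (S : {set V}) (u : V) (M : nmodType) (F : {ffun V -> C} -> M) :
    u \notin S ->
  \sum_(f in colourings (u |: S)) F (upd f u c0)
    = \sum_(g in colourings S) F g *+ #|avail S g u|.
Proof.
move=> uS; rewrite (partition_big (fun f => upd f u c0) (mem (colourings S))) /=;
  last by move=> f; exact: upd_colourings.
apply: eq_bigr => g gS; rewrite -card_extensions // -sumr_const.
by apply: eq_big => [f|f]; rewrite ?inE // => /andP[_ /eqP->].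
Qed.

Lemma card_colourings_setU1 (S : {set V}) (u : V) : u \notin S ->
  #|colourings (u |: S)| = (\sum_(g in colourings S) #|avail S g u|)%N.
Proof.
move=> uS; have := sum_extensions (fun=> 1%N : nat) uS.
rewrite sumr_const => h; rewrite -[LHS]natn h.
by apply: eq_bigr => g _; rewrite natn.
Qed.

(** Each extension of a colouring [g] of [S :\ u] has as weight the inverse of the number of
    extensions, so [g] contributes 1 in total, or 0 if it does not extend. *)
Lemma sum_inv_avail (R : numFieldType) (S : {set V}) (u : V) : u \in S ->
  \sum_(f in colourings S) (#|avail S f u|%:R^-1 : R) <= #|colourings (S :\ u)|%:R.
Proof.
move=> uS; have uSu : u \notin S :\ u by rewrite setD11.
have := sum_extensions (fun g => #|avail (S :\ u) g u|%:R^-1 : R) uSu.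
rewrite setD1K // => h.
under eq_bigr do rewrite -{1}(setD1K uS) (avail_upd _ _ _ c0).
rewrite h -sumr_const ler_sum // => g _.
rewrite -[leLHS]mulr_natr; have [->|n0] := posnP #|avail (S :\ u) g u|.
  by rewrite mulr0.
by rewrite mulVf // pnatr_eq0 -lt0n.
Qed.

(** * Resampling the neighbourhood of a vertex *)

Hypothesis e_tri : triangle_free e.

Definition nbrs (S : {set V}) (v : V) : {set V} := [set u in S | e v u].

(** Having equal images under [forget N] encodes conditioning on the colours outside [N]. *)
Definition forget (N : {set V}) (f : {ffun V -> C}) : {ffun V -> C} :=
  [ffun w => if w \in N then c0 else f w].

(* The neighbours of [v] are pairwise non-adjacent, so recolouring some of them
   does not affect the colours available at the others. *)
Lemma avail_nbrs (S : {set V}) (v u : V) (f g : {ffun V -> C}) :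
    forget (nbrs S v) f = forget (nbrs S v) g -> u \in nbrs S v ->
  avail S f u = avail S g u.
Proof.
rewrite inE => fg /andP[uS vu].
have eqfg w : e u w -> f w = g w.
  move=> uw; move/ffunP/(_ w): fg; rewrite !ffunE inE.
  case: ifP => // /andP[_ vw]; case: (e_tri (x := v) (y := u) (z := w)).
  by split.
by apply/setP => x; apply/availP/availP => -[xA h]; split=> // w wS uw;
  have := h w wS uw; rewrite eqfg.
Qed.

(* The colourings that agree with [f0] off [N(v)] form a product set. *)
Lemma mem_class (S : {set V}) (v : V) (f0 f : {ffun V -> C}) :
    f0 \in colourings S ->
  (f \in colourings S) && (forget (nbrs S v) f == forget (nbrs S v) f0) =
  (f \in family (fun w => mem
     (if w \in nbrs S v then avail S f0 w else [set f0 w]))).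
Proof.
move=> f0S; have [hA h0 hp] := colouringsP _ _ f0S.
apply/andP/familyP => [[fS /eqP ff0] w|h].
  case: ifPn => [wN|wN]; last first.
    by move/ffunP/(_ w): ff0; rewrite !ffunE (negPf wN) => ->; rewrite inE.
  rewrite -(avail_nbrs ff0 wN); apply: mem_avail fS.
  by move: wN; rewrite inE => /andP[].
have hN w : w \in nbrs S v -> f w \in avail S f0 w.
  by move=> wN; have := h w; rewrite wN.
have hO w : w \notin nbrs S v -> f w = f0 w.
  by move=> wN; have := h w; rewrite (negPf wN) inE => /eqP.
split; last first.
  by apply/eqP/ffunP => w; rewrite !ffunE; case: ifPn => // /hO.
apply/colouringsP; split=> [w wS|w wS|w u wS uS wu].
- have [/hN/availP[]//|/hO->] := boolP (w \in nbrs S v); exact: hA.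
- by rewrite hO ?h0 // inE (negPf wS).
- have [wN|wN] := boolP (w \in nbrs S v); have [uN|uN] := boolP (u \in nbrs S v).
  + move: wN uN; rewrite !inE => /andP[_ vw] /andP[_ vu].
    by case: (e_tri (x := v) (y := w) (z := u)).
  + have /availP[_ ] := hN w wN => /(_ u uS wu); by rewrite (hO u uN) eq_sym.
  + have /availP[_ ] := hN u uN => /(_ w wS); rewrite e_sym => /(_ wu).
    by rewrite (hO w wN).
  + by rewrite !hO //; apply: hp.
Qed.

Lemma card_class (N : {set V}) (f0 : {ffun V -> C}) (F : V -> {set C}) :
  #|[set f : {ffun V -> C} | f \in family (fun w => mem
      (if w \in N then F w else [set f0 w]))]| = (\prod_(w in N) #|F w|)%N.
Proof.
rewrite card_family_prod [RHS]big_mkcond; apply: eq_bigr => w _.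
by case: ifP => // _; rewrite cards1.
Qed.

Lemma card_availE (R : pzSemiRingType) (S : {set V}) (f : {ffun V -> C}) (v : V) :
  #|avail S f v|%:R
    = \sum_(x in A v) [forall u in nbrs S v, f u != x]%:R :> R.
Proof.
rewrite -sum1_card natr_sum (eq_bigl (fun x => (x \in A v) &&
    [forall u in nbrs S v, f u != x])); last first.
  move=> x; rewrite inE; congr andb; apply/forall_inP/forall_inP => h w.
    by rewrite inE => /andP[wS vw]; exact: (implyP (h w wS)).
  by move=> wS; apply/implyP => vw; apply: h; rewrite inE wS.
by rewrite big_mkcondr; apply: eq_bigr => x _; case: ifP.
Qed.

(** In a product set, avoiding [x] deletes [x] from every factor. A factor of size [s] that contains
    [x] shrinks by [1 - 1/s]; the others are unchanged. *)
Lemma sum_avoiding (R : numFieldType) (S : {set V}) (v : V) (x : C)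
    (f0 : {ffun V -> C}) : f0 \in colourings S ->
  \sum_(f in colourings S | forget (nbrs S v) f == forget (nbrs S v) f0)
     [forall u in nbrs S v, f u != x]%:R
  = (\prod_(u in nbrs S v) #|avail S f0 u|)%:R
    * \prod_(u in nbrs S v)
        (1 - (x \in avail S f0 u)%:R / #|avail S f0 u|%:R) :> R.
Proof.
move=> f0S; set N := nbrs S v.
transitivity (\prod_(u in N) #|avail S f0 u :\ x|%:R : R); last first.
  rewrite natr_prod -big_split /=; apply: eq_bigr => u uN.
  have : (0 < #|avail S f0 u|)%N.
    apply/card_gt0P; exists (f0 u); apply: mem_avail => //.
    by move: uN; rewrite inE => /andP[].
  rewrite lt0n => s0; rewrite mulrBr mulr1 mulrCA divff ?pnatr_eq0 // mulr1.
  by rewrite [in RHS](cardsD1 x) natrD addrAC subrr add0r.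
rewrite -natr_prod -(card_class N f0) -sum1_card natr_sum.
rewrite (eq_bigr (fun f : {ffun V -> C} =>
    if [forall u in N, f u != x] then 1 else 0 : R)); last by move=> f _; case: ifP.
rewrite -big_mkcondr; apply: eq_bigl => f; rewrite mem_class // inE.
apply/andP/familyP => [[/familyP h /forall_inP hx] w|h].
  by have := h w; case: ifP => // wN fw; rewrite in_setD1 hx.
split; last first.
  by apply/forall_inP => w wN; have := h w; rewrite wN !inE => /andP[].
apply/familyP => w; have := h w; case: ifP => // wN.
by rewrite in_setD1 => /andP[].
Qed.

Lemma sum_class_avail (R : realType) (S : {set V}) (v : V) (f0 : {ffun V -> C}) :
    f0 \in colourings S ->
  \sum_(f in colourings S | forget (nbrs S v) f == forget (nbrs S v) f0)
    16^-1 * (3 * #|A v|%:R - \sum_(u in nbrs S v) (1 + 2 / #|avail S f u|%:R))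
  <= \sum_(f in colourings S | forget (nbrs S v) f == forget (nbrs S v) f0)
       #|avail S f v|%:R :> R.
Proof.
move=> f0S; set N := nbrs S v.
set P := (\prod_(u in N) #|avail S f0 u|)%N.
have s_gt0 u : u \in N -> (0 < #|avail S f0 u|)%N.
  move=> uN; apply/card_gt0P; exists (f0 u); apply: mem_avail => //.
  by move: uN; rewrite inE => /andP[].
rewrite [leRHS](eq_bigr (fun f : {ffun V -> C} =>
    \sum_(x in A v) [forall u in N, f u != x]%:R : R));
  last by move=> f _; exact: card_availE.
rewrite exchange_big /= [leRHS](eq_bigr _ (fun x _ => sum_avoiding R v x f0S)).
rewrite -[leRHS]mulr_sumr.
(* The left summand is constant on the class, so both sides carry the class size [P] as a factor. *)
rewrite [leLHS](eq_bigr (fun=> 16^-1 *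
    (3 * #|A v|%:R - \sum_(u in N) (1 + 2 / #|avail S f0 u|%:R)))); last first.
  move=> f /andP[_ /eqP ff0]. congr (_ * _); congr (_ - _).
  apply: eq_bigr => u uN.
  by rewrite (avail_nbrs ff0 uN).
rewrite (eq_bigl _ _ (fun f => mem_class v f f0S)) -/N big_const -cardsE.
rewrite card_class -/P iter_addr_0 -[leLHS]mulr_natl ler_wpM2l //.
pose y u x : R := (x \in avail S f0 u)%:R / #|avail S f0 u|%:R.
apply: (@le_trans _ _ (\sum_(x in A v)
    16^-1 * (3 - \sum_(u in N) (y u x + 2 * y u x ^+ 2)))); last first.
  apply: ler_sum => x _; apply: prod_1B_ge => u uN; rewrite /y.
  case: (x \in _); last by left; rewrite mul0r lexx invr_ge0 ler0n.
  rewrite mul1r; case: #|avail S f0 u| (s_gt0 u uN) => // -[|s] _.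
    by right; rewrite invr1.
  by left; rewrite invr_ge0 ler0n lef_pV2 ?posrE ?ltr0n // ler_nat.
rewrite -mulr_sumr ler_wpM2l ?invr_ge0 // sumrB sumr_const -(mulr_natr 3) lerD2l.
rewrite lerN2 exchange_big /=; apply: ler_sum => u uN.
set s := #|avail S f0 u|; have s0 : (s%:R : R) != 0.
  by rewrite pnatr_eq0 -lt0n s_gt0.
(* Only the [x] in [avail S f0 u] contribute. At most [s] of them lie in [A v], and [s] such terms
   add up to [1 + 2 / s]. *)
rewrite (eq_bigr (fun x => if x \in avail S f0 u then
    s%:R^-1 + 2 * s%:R^-1 ^+ 2 else 0)); last first.
  move=> x _; rewrite /y; case: ifP; rewrite ?mul1r // mul0r.
  by rewrite expr0n mulr0 addr0.
rewrite -big_mkcondr sumr_const.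
have -> : 1 + 2 / s%:R = (s%:R^-1 + 2 * s%:R^-1 ^+ 2) *+ s :> R.
  by rewrite -[RHS]mulr_natr; field.
apply: ler_wpMn2l; last by apply: subset_leq_card; apply/fintype.subsetP => x /andP[].
by rewrite addr_ge0 ?mulr_ge0 ?exprn_ge0 ?invr_ge0.
Qed.

Lemma sum_avail_ge (R : realType) (S : {set V}) (v : V) :
  \sum_(f in colourings S)
    16^-1 * (3 * #|A v|%:R - \sum_(u in nbrs S v) (1 + 2 / #|avail S f u|%:R))
  <= \sum_(f in colourings S) #|avail S f v|%:R :> R.
Proof.
pose r := forget (nbrs S v).
rewrite [leLHS](partition_big r (mem (r @: colourings S))) /=; last first.
  by move=> f fS; exact: imset_f.
rewrite [leRHS](partition_big r (mem (r @: colourings S))) /=; last first.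
  by move=> f fS; exact: imset_f.
by apply: ler_sum => _ /imsetP[f0 f0S ->]; exact: sum_class_avail.
Qed.

(** * The growth inequality *)

Hypothesis A_ge : forall v, (deg e v + 3 <= 2 * #|A v|)%N.
Hypothesis deg_ge : forall v, (524 <= deg e v)%N.

Lemma colourings_growth (R : realType) (S : {set V}) (v : V) : v \notin S ->
  8 * #|colourings S|%:R <= #|colourings (v |: S)|%:R :> R.
Proof.
have [n] := ubnP #|S|; elim: n S v => // n IHn S v Sn vS.
rewrite card_colourings_setU1 // natr_sum; apply: le_trans (sum_avail_ge R S v).
set c : R := #|colourings S|%:R; set N := nbrs S v.
have c_ge0 : 0 <= c by exact: ler0n.
have inv_le u : u \in N ->
    \sum_(f in colourings S) (#|avail S f u|%:R^-1 : R) <= c / 8.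
  rewrite inE => /andP[uS _]; apply: le_trans (sum_inv_avail R uS) _.
  (* Induction applies to the smaller set [S :\ u] and the vertex [u]. *)
  rewrite ler_pdivlMr // mulrC /c -{2}(setD1K uS); apply: IHn.
    by move: Sn; rewrite (cardsD1 u) uS ltnS.
  by rewrite setD11.
have N_le : (#|N| <= deg e v)%N.
  by apply: subset_leq_card; apply/fintype.subsetP => u; rewrite inE => /andP[].
have : \sum_(f in colourings S) \sum_(u in N) (1 + 2 / #|avail S f u|%:R)
    <= (deg e v)%:R * (5 / 4 * c).
  rewrite exchange_big /=.
  (* Here [5 / 4] is [1 + 2 / 8], with [1 / 8] from [inv_le]. *)
  apply: (@le_trans _ _ (\sum_(u in N) (5 / 4 * c))); last first.
    rewrite sumr_const -[leLHS]mulr_natl ler_wpM2r ?ler_nat //; lra.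
  apply: ler_sum => u uN; rewrite big_split /= -mulr_sumr sumr_const.
  have := inv_le u uN; rewrite -/c; lra.
rewrite -mulr_sumr sumrB sumr_const -(mulr_natr (3 * _)) -/c => h.
have A_geR : (deg e v)%:R + 3 <= 2 * #|A v|%:R :> R.
  by rewrite -!natrM -!natrD ler_nat A_ge.
have deg_geR : 524 <= (deg e v)%:R :> R by rewrite ler_nat deg_ge.
(* Scaled by [c], the bounds combine linearly; at degree 524 the factor is [135.5 / 16 >= 8]. *)
have hA : c * ((deg e v)%:R + 3) <= c * (2 * #|A v|%:R) by rewrite ler_wpM2l.
have hd : c * 524 <= c * (deg e v)%:R by rewrite ler_wpM2l.
by nra.
Qed.

End PartialColourings.

(** * Existence of colourings and reduction to finite lists *)

Local Open Scope nat_scope.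

Lemma exists_list_colouring (V : finType) (e : rel V) (C : finType) (A : V -> {set C}) :
    simple_graph e -> triangle_free e -> min_degree_at_least e 524 ->
    (forall v, deg e v + 3 <= 2 * #|A v|)%N ->
  exists f : V -> C, (forall v, f v \in A v) /\ (forall u v, e u v -> f u != f v).
Proof.
move=> [e_sym e_irr] e_tri deg_ge A_ge.
(* The dummy colour [c0] is taken from the list of some vertex, so the empty graph is treated
   apart. *)
have [v0 _|V0] := pickP (@predT V); last first.
  by exists (fun v => False_rect C (notF (esym (V0 v)))); split=> v; have := V0 v.
have /card_gt0P[c0 _] : (0 < #|A v0|)%N by have := A_ge v0; case: #|A v0| => //; lia.
have pos S : (0 < #|colourings e c0 A S|)%N.
  have [n] := ubnP #|S|; elim: n S => // n IHn S Sn.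
  have [->|[v vS]] := set_0Vmem S; first exact: colourings0_gt0.
  have := @colourings_growth V C e c0 A e_sym e_irr e_tri A_ge deg_ge
    Rdefinitions.R (S :\ v) v.
  rewrite setD11 setD1K // => /(_ isT).
  rewrite -natrM ler_nat; apply: leq_trans; rewrite muln_gt0 IHn //.
  by move: Sn; rewrite (cardsD1 v) vS ltnS.
have /card_gt0P[f /colouringsP[fA _ fp]] := pos setT.
by exists f; split=> [v|u v uv]; [exact: fA|exact: fp].
Qed.

(** Truncates a possibly infinite list to exactly [n] colours. *)
Lemma card_at_least_uniq (n : nat) (B : set nat) : card_at_least n B ->
  exists s : seq nat, [/\ uniq s, size s = n & forall x, x \in s -> B x].
Proof.
case/pcard_leP => f; exists (map (fun i : 'I_n => f (i : nat)) (enum 'I_n)).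
have mem (i : 'I_n) : (i : nat) \in `I_n%classic by apply: mem_set; exact: ltn_ord.
split; last by move=> x /mapP[i _ ->]; apply: funS => /=.
- rewrite map_inj_in_uniq ?enum_uniq // => i j _ _ fij.
  by apply: val_inj; apply: (inj (f := f)) fij; exact: mem.
- by rewrite size_map size_enum_ord.
Qed.

Theorem theorem2p1 (V : finType) (e : rel V)
    (he : simple_graph e) (htri : triangle_free e)
    (hdeg : min_degree_at_least e 524)
    (L : list_assignment V)
    (hL : forall v : V, card_at_least (k (deg e v)) (L v)) :
  exists c : V -> nat, proper_list_colouring e L c.
Proof.
have /choice[s hs] v := card_at_least_uniq (hL v).
(* [N] bounds all the retained colours, so ['I_N.+1] is a common finite palette. *)
pose M v := (\max_(x <- s v) x)%N; pose N := (\max_v M v)%N.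
have ltN v x : x \in s v -> (x < N.+1)%N.
  move=> xs; rewrite ltnS (leq_trans _ (leq_bigmax (F := M) v)) //.
  exact: (leq_bigmax_seq (F := id)) xs isT.
pose A v : {set 'I_N.+1} := [set x : 'I_N.+1 | (x : nat) \in s v].
have cardA v : #|A v| = k (deg e v).
  have [us <- _] := hs v; rewrite cardE -(size_map val).
  apply/perm_size/uniq_perm; rewrite ?(map_inj_uniq val_inj) ?enum_uniq // => x.
  apply/mapP/idP => [[i]|xs]; first by rewrite mem_enum inE => + ->.
  by exists (Ordinal (ltN v x xs)); rewrite // mem_enum inE.
have [|f [fA fp]] := exists_list_colouring (A := A) he htri hdeg.
  (* Rounding up gives [k d >= (d + 3) / 2]. *)
  by move=> v; rewrite cardA /k; lia.
exists (fun v => nat_of_ord (f v)); split=> [v|u v /fp/eqP ne /val_inj]//.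
by have [_ _] := hs v; apply; have := fA v; rewrite inE.
Qed.
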